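(* Consider the delayed constrained online convex optimization problem and the DTC-OCO algorithm with feedback delay $\tau\ge 1$ described in the context, and suppose Assumptions 1, 2 and 3 of the context hold. Then for any $\alpha,\gamma>0$ and $\eta\ge\gamma^2\beta^2$, the static regret $\mathrm{RE}_{\mathrm s}(T)=\sum_{t=1}^{T}[f_t(\mathbf{x}_t)-f_t(\mathbf{x}^\star)]$ of DTC-OCO is upper bounded by $$\mathrm{RE}_{\mathrm s}(T)\le\frac{D^2}{4\alpha}T+\frac{\gamma^2G^2}{2}+\gamma^2\Delta_{\mathbf g}+(\alpha\tau+\eta)R^2+DR\tau .$$
   Context: Problem data. $T\ge1$ is the time horizon and $\tau\ge1$ an integer (feedback delay). $\mathcal{X}_0\subseteq\mathbb{R}^n$ is a compact convex set. For $t=1,2,\dots$, $f_t:\mathbb{R}^n\to\mathbb{R}$ is a convex differentiable loss function and $\mathbf{g}_t=[g_t^1,\dots,g_t^C]^T:\mathbb{R}^n\to\mathbb{R}^C$ is a constraint function with each component $g_t^c$ convex, $c\in\mathcal{C}=\{1,\dots,C\}$. $\preceq,\succeq$ are entrywise inequalities. Assumptions. (1) There is $D>0$ with $\|\nabla f_t(\mathbf{x})\|_2\le D$ for all $\mathbf{x}\in\mathcal{X}_0$ and all $t$. (2.1) There is $\beta>0$ with $\|\mathbf{g}_t(\mathbf{x})-\mathbf{g}_t(\mathbf{y})\|_2\le\beta\|\mathbf{x}-\mathbf{y}\|_2$ for all $\mathbf{x},\mathbf{y}\in\mathcal{X}_0$ and all $t$. (2.2) There is $G>0$ with $\|\mathbf{g}_t(\mathbf{x})\|_2\le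 G$ for all $\mathbf{x}\in\mathcal{X}_0$ and all $t$. (2.3) There is $\epsilon>0$ such that for every $t$ there is $\tilde{\mathbf{x}}_t\in\mathcal{X}_0$ with $\mathbf{g}_t(\tilde{\mathbf{x}}_t)\preceq-\epsilon\mathbf{1}$. (3) There is $R>0$ with $\|\mathbf{x}-\mathbf{y}\|_2\le R$ for all $\mathbf{x},\mathbf{y}\in\mathcal{X}_0$. DTC-OCO algorithm with parameters $\alpha,\eta,\gamma>0$. Initialization: $\mathbf{x}_t\in\mathcal{X}_0$ arbitrary and $\mathbf{Q}_t=\mathbf{0}\in\mathbb{R}^C$ for $1\le t\le\tau$, and $\mathbf{g}_0(\mathbf{x})\equiv\mathbf{0}$. For each $t>\tau$: first, $\mathbf{x}_t$ is the minimizer over $\mathbf{x}\in\mathcal{X}_0$ of $$[\nabla f_{t-\tau}(\mathbf{x}_{t-\tau})]^T(\mathbf{x}-\mathbf{x}_{t-\tau})+[\mathbf{Q}_{t-1}+\gamma\mathbf{g}_{t-\tau-1}(\mathbf{x}_{t-1})]^T[\gamma\mathbf{g}_{t-\tau}(\mathbf{x})]+\alpha\|\mathbf{x}-\mathbf{x}_{t-\tau}\|_2^2+\eta\|\mathbf{x}-\mathbf{x}_{t-1}\|_2^2;$$ then the virtual queue $\mathbf{Q}_t=[Q_t^1,\dots,Q_t^C]^T$ is updated for each $c\in\mathcal{C}$ by $Q_t^c=\max\{-\gamma g_{t-\tau}^c(\mathbf{x}_t),\,Q_{t-1}^c+\gamma g_{t-\tau}^c(\mathbf{x}_t)\}$.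 Benchmark and variation measure. $\mathbf{x}^\star\in\arg\min_{\mathbf{x}\in\mathcal{X}_0}\{\sum_{t=1}^Tf_t(\mathbf{x}) : \mathbf{g}_t(\mathbf{x})\preceq\mathbf{0}\ \text{for all } t\}$ (the feasible set is assumed nonempty, so that $\mathbf{x}^\star$ exists; any choice of minimizer). $\Delta_{\mathbf g}=\sum_{t=1}^T\max_{\mathbf{x}\in\mathcal{X}_0}\|\mathbf{g}_t(\mathbf{x})-\mathbf{g}_{t-1}(\mathbf{x})\|_2^2$. *)

(* Defs.v *)
From HB Require Import structures.
From mathcomp Require Import all_boot all_order all_algebra.
From mathcomp Require Import all_classical all_reals all_analysis.

Set Implicit Arguments.
Unset Strict Implicit.
Unset Printing Implicit Defensive.

Import Order.TTheory GRing.Theory Num.Theory.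
Import numFieldNormedType.Exports.

Local Open Scope classical_set_scope.
Local Open Scope ring_scope.

Section Euclidean.
Context {R : realType}.

Definition dot n (u v : 'rV[R]_n) : R := \sum_i u 0 i * v 0 i.

(* The canonical norm [`|u|] on matrices is the sup norm, hence this
   separate Euclidean norm; both induce the same topology, so [compact] and
   [differentiable] can be taken from the canonical structure. *)
Definition l2norm n (u : 'rV[R]_n) : R := Num.sqrt (dot u u).

(* The vector of partial derivatives; meaningful at the points where [f] is
   differentiable. *)
Definition gradient n (f : 'rV[R]_n -> R) (x : 'rV[R]_n) : 'rV[R]_n :=
  \row_i 'D_(delta_mx 0 i) f x.

End Euclidean.

Definition argmin (R : realType) (V : Type) (A : set V) (F : V -> R) : set V :=
  [set x | A x /\ forall y, A y -> F x <= F y].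

Section DTC_OCO.
Context {R : realType} {n C : nat}.
Variables (X0 : set 'rV[R]_n).
Variables (f : nat -> 'rV[R]_n -> R) (g : nat -> 'rV[R]_n -> 'rV[R]_C).

Definition dtc_oco_objective (tau : nat) (alpha eta gamma : R)
    (x : nat -> 'rV[R]_n) (Q : nat -> 'rV[R]_C) (t : nat) (y : 'rV[R]_n) : R :=
  dot (gradient (f (t - tau)%N) (x (t - tau)%N)) (y - x (t - tau)%N)
  + dot (Q (t - 1)%N + gamma *: g (t - tau - 1)%N (x (t - 1)%N))
        (gamma *: g (t - tau)%N y)
  + alpha * l2norm (y - x (t - tau)%N) ^+ 2
  + eta * l2norm (y - x (t - 1)%N) ^+ 2.

(* Rounds are numbered from 1: [x 0] and [Q 0] are never constrained or used. *)
Definition dtc_oco_run (tau : nat) (alpha eta gamma : R)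
    (x : nat -> 'rV[R]_n) (Q : nat -> 'rV[R]_C) : Prop :=
  [/\ forall t, (1 <= t <= tau)%N -> X0 (x t) /\ Q t = 0,
      forall t, (tau < t)%N ->
        argmin X0 (dtc_oco_objective tau alpha eta gamma x Q t) (x t)
    & forall t, (tau < t)%N -> forall c : 'I_C,
        Q t 0 c = Num.max (- (gamma * g (t - tau)%N (x t) 0 c))
                          (Q (t - 1)%N 0 c + gamma * g (t - tau)%N (x t) 0 c)].

Definition feasible (T : nat) : set 'rV[R]_n :=
  [set y | X0 y /\ forall t, (1 <= t <= T)%N -> forall c : 'I_C, g t y 0 c <= 0].

Definition static_benchmark (T : nat) : set 'rV[R]_n :=
  argmin (feasible T) (fun y => \sum_(1 <= t < T.+1) f t y).

Definition static_regret (T : nat) (x : nat -> 'rV[R]_n) (xs : 'rV[R]_n) : R :=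
  \sum_(1 <= t < T.+1) (f t (x t) - f t xs).

(* The [sup] is a maximum when [X0] is nonempty and compact and the [g t] are
   convex on the whole space, hence continuous. *)
Definition constraint_variation (T : nat) : R :=
  \sum_(1 <= t < T.+1)
    sup [set l2norm (g t y - g (t - 1)%N y) ^+ 2 | y in X0].

End DTC_OCO.

(* Main.v *)
Require Import Defs.
From HB Require Import structures.
From mathcomp Require Import all_boot all_order all_algebra.
From mathcomp Require Import all_classical all_reals all_analysis.
From mathcomp Require Import ring lra.

Set Implicit Arguments.
Unset Strict Implicit.
Unset Printing Implicit Defensive.

Import Order.TTheory GRing.Theory Num.Theory.
Import numFieldNormedType.Exports.

Local Open Scope classical_set_scope.
Local Open Scope ring_scope.

(** The objective minimised in round [s + tau] is [2 (alpha + eta)]-strongly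
    convex, because the weight [Q_(t-1) + gamma g_(t-tau-1)(x_(t-1))] of the
    constraint term is nonnegative by the queue update.  Comparing the minimiser
    [x_(s+tau)] with [xs], where the constraint term is nonpositive, and
    linearising [f_s] at [x_s] bounds [f_s(x_s) - f_s(xs)] by
    - a Young term [D^2 / (4 alpha)] (the [alpha]-regulariser pays for the delay);
    - differences of squared distances to [xs], which telescope;
    - the decrease of [(|Q_t|^2 - |gamma g_(t-tau)(x_t)|^2) / 2], plus half the
      squared change of [gamma g], whose part due to the motion of [x] is
      absorbed by the [eta]-regulariser since [eta >= gamma^2 beta^2].
    The run is defined past the horizon, so this can be summed over all
    [s = 1..T], using the decisions up to round [T + tau]; no separate treatment
    of the last [tau] rounds is needed and the term [D R tau] is only slack. *)

(** * Euclidean inequalities, first-order convexity and telescoping sums *)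

Section EuclideanConvex.
Context {R : realType}.

Lemma l2norm_sqr n (u : 'rV[R]_n) : l2norm u ^+ 2 = dot u u.
Proof. by rewrite sqr_sqrtr// sumr_ge0// => i _; rewrite -expr2 sqr_ge0. Qed.

Lemma l2norm_ge0 n (u : 'rV[R]_n) : 0 <= l2norm u.
Proof. exact: sqrtr_ge0. Qed.

Lemma l2norm0 n : l2norm (0 : 'rV[R]_n) = 0.
Proof.
by rewrite /l2norm /dot big1 ?sqrtr0// => i _; rewrite mxE mul0r.
Qed.

Lemma l2norm_sqr_le n (u : 'rV[R]_n) (a : R) :
  l2norm u <= a -> l2norm u ^+ 2 <= a ^+ 2.
Proof.
by move=> ua; rewrite lerXn2r// nnegrE ?(le_trans _ ua)// l2norm_ge0.
Qed.

Lemma dot_conv n (p u v : 'rV[R]_n) (l : R) :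
  dot p (l *: u + (1 - l) *: v) = l * dot p u + (1 - l) * dot p v.
Proof.
rewrite /dot !mulr_sumr -big_split; apply: eq_bigr => i _ /=.
by rewrite !mxE; ring.
Qed.

Lemma l2norm_sqr_conv n (u v a : 'rV[R]_n) (l : R) :
  l2norm (l *: u + (1 - l) *: v - a) ^+ 2 =
  l * l2norm (u - a) ^+ 2 + (1 - l) * l2norm (v - a) ^+ 2
  - l * (1 - l) * l2norm (u - v) ^+ 2.
Proof.
rewrite !l2norm_sqr /dot !mulr_sumr -big_split -sumrB.
by apply: eq_bigr => i _ /=; rewrite !mxE; ring.
Qed.

Lemma l2normN n (u : 'rV[R]_n) : l2norm (- u) = l2norm u.
Proof.
by congr Num.sqrt; apply: eq_bigr => i _; rewrite mxE mulrNN.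
Qed.

Lemma l2norm_sqrD_le n (u v : 'rV[R]_n) :
  l2norm (u + v) ^+ 2 <= 2 * (l2norm u ^+ 2 + l2norm v ^+ 2).
Proof.
rewrite !l2norm_sqr /dot mulrDr !mulr_sumr -big_split.
by apply: ler_sum => i _ /=; rewrite !mxE; have := sqr_ge0 (u 0 i - v 0 i); lra.
Qed.

Lemma l2norm_sqrZ n (a : R) (u : 'rV[R]_n) :
  l2norm (a *: u) ^+ 2 = a ^+ 2 * l2norm u ^+ 2.
Proof.
rewrite !l2norm_sqr /dot mulr_sumr; apply: eq_bigr => i _.
by rewrite !mxE; ring.
Qed.

Lemma young_dot n (p u : 'rV[R]_n) (a : R) : 0 < a ->
  - dot p u <= l2norm p ^+ 2 / (4 * a) + a * l2norm u ^+ 2.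
Proof.
move=> a_gt0; rewrite !l2norm_sqr /dot mulr_suml mulr_sumr -sumrN -big_split.
apply: ler_sum => i _ /=; rewrite -subr_ge0.
suff -> : p 0 i * p 0 i / (4 * a) + a * (u 0 i * u 0 i) - - (p 0 i * u 0 i) =
          a * (u 0 i + p 0 i / (2 * a)) ^+ 2.
  by rewrite mulr_ge0 ?sqr_ge0// ltW.
by field; rewrite gt_eqF.
Qed.

Lemma convex_function_le (E : lmodType R) (f : E -> R) :
  convex_function [set: convex_lmodType E] f ->
  forall (u v : E) (l : R), 0 <= l <= 1 ->
    f (l *: u + (1 - l) *: v) <= l * f u + (1 - l) * f v.
Proof.
move=> fC u v l /andP[l0 l1].
by apply: (fC (Itv01 l0 l1) u v); rewrite inE.
Qed.

Lemma convex_set_in (E : lmodType R) (A : set E) :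
  convex_set (A : set (convex_lmodType E)) ->
  forall (u v : E) (l : R), A u -> A v -> 0 <= l <= 1 ->
    A (l *: u + (1 - l) *: v).
Proof.
move=> AC u v l Au Av /andP[l0 l1]; apply/set_mem.
by apply: (AC u v (Itv01 l0 l1)); exact/mem_set.
Qed.

Lemma dot_gradient n (f : 'rV[R]_n -> R) (x v : 'rV[R]_n) :
  differentiable f x -> dot (gradient f x) v = 'D_v f x.
Proof.
move=> fx; rewrite [in RHS](row_sum_delta v) deriveE// linear_sum.
apply: eq_bigr => i _; rewrite linearZ/= /gradient mxE deriveE//.
by rewrite mulrC.
Qed.

(** By convexity the difference quotients along [y - x] with step in (0, 1] are at most [f y - f x];
    the bound passes to the right limit. *)
Lemma convex_gradient_le n (f : 'rV[R]_n -> R) (x y : 'rV[R]_n) :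
  convex_function [set: convex_lmodType 'rV[R]_n] f -> differentiable f x ->
  f x + dot (gradient f x) (y - x) <= f y.
Proof.
move=> fC fx; rewrite dot_gradient// -lerBrDl.
have /cvg_dnbhs_at_right fD := diff_derivable (v := y - x) fx.
apply: (cvgr_to_le fD); near=> h.
have h_gt0 : 0 < h by [].
have h_le1 : h <= 1 by near: h; exact: nbhs_right_le.
rewrite /= -[_ *: _]/(h^-1 * _) ler_pdivrMl//.
have -> : h *: (y - x) + x = h *: y + (1 - h) *: x.
  by apply/rowP => i; rewrite !mxE; ring.
have := convex_function_le fC y x (l := h); rewrite ltW// h_le1 => /(_ isT).
by lra.
Unshelve. all: by end_near. Qed.

Lemma le_of_lt1_slack (a b c : R) :
  (forall l, 0 < l < 1 -> a + (1 - l) * c <= b) -> a + c <= b.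
Proof.
move=> H; rewrite leNgt; apply/negP => bac.
(* At [l = 1/2], together with [b < a + c], this forces [c > 0]. The next choice of [l] makes
   [l * c] half the excess [a + c - b], so the left side still exceeds [b]. *)
have c2 : a + (1 - 2^-1) * c <= b by apply: H; lra.
have c_gt0 : 0 < c by lra.
have d01 : 0 < (a + c - b) / (2 * c) < 1.
  by apply/andP; split; [rewrite divr_gt0 | rewrite ltr_pdivrMr]; lra.
have := H _ d01.
have -> : (1 - (a + c - b) / (2 * c)) * c = c - (a + c - b) / 2.
  by field; rewrite gt_eqF.
by lra.
Qed.

(** Compare [x] with the point [l *: y + (1 - l) *: x] of [A], cancel a factor [l], then let [l]
    tend to 0. *)
Lemma strongly_convex_argmin n (A : set 'rV[R]_n) (F : 'rV[R]_n -> R) (m : R)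
    (x y : 'rV[R]_n) :
  convex_set (A : set (convex_lmodType 'rV[R]_n)) ->
  (forall l, 0 < l < 1 -> F (l *: y + (1 - l) *: x) <=
     l * F y + (1 - l) * F x - l * (1 - l) * (m * l2norm (y - x) ^+ 2)) ->
  argmin A F x -> A y -> F x + m * l2norm (y - x) ^+ 2 <= F y.
Proof.
move=> AC FC [Ax xmin] Ay; apply: le_of_lt1_slack => l /andP[l0 l1].
have l01 : 0 <= l <= 1 by rewrite !ltW.
have := xmin _ (convex_set_in AC Ay Ax l01).
move=> /le_trans/(_ (FC l _)); rewrite l0 l1 => /(_ isT) Fxy.
by rewrite -(ler_pM2l l0); lra.
Qed.

(** Coordinatewise, the square of a max is at most the sum of the squares, so
    [Q'^2 <= w'^2 + (Q + w')^2]; the cross term [- w * w'] is rewritten by polarization. *)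
Lemma queue_drift n (Q Q' w w' : 'rV[R]_n) :
  (forall c, Q' 0 c = Num.max (- w' 0 c) (Q 0 c + w' 0 c)) ->
  - dot (Q + w) w' <= (l2norm Q ^+ 2 - l2norm w ^+ 2) / 2
    - (l2norm Q' ^+ 2 - l2norm w' ^+ 2) / 2 + l2norm (w' - w) ^+ 2 / 2.
Proof.
move=> Q'E; rewrite !l2norm_sqr /dot -!sumrB !mulr_suml -sumrN -sumrB -big_split.
apply: ler_sum => c _ /=; rewrite !mxE Q'E.
set a := - w' 0 c; set b := Q 0 c + w' 0 c.
have max_sqr : Num.max a b * Num.max a b <= a * a + b * b.
  by case: (leP a b) => _; have := sqr_ge0 a; have := sqr_ge0 b; rewrite !expr2; lra.
by move: max_sqr; rewrite /a /b; lra.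
Qed.

(** A difference with lag [tau] is a sum of [tau] one-step differences, each of which telescopes
    over [T] terms. *)
Lemma telescope_window (d : nat -> R) (T tau : nat) :
  \sum_(0 <= k < T) (d k - d (k + tau)%N) =
  \sum_(0 <= j < tau) (d j - d (T + j)%N).
Proof.
elim: tau => [|tau IH].
  by rewrite big_nil big1// => k _; rewrite addn0 subrr.
rewrite big_nat_recr//= -IH -(opprB _ (d tau)) -[X in _ - (_ - d X)]add0n.
rewrite -(@telescope_sumr _ 0 T (fun k => d (k + tau)%N))// -sumrB.
by apply: eq_bigr => k _; rewrite addnS addSn; ring.
Qed.

End EuclideanConvex.

Section DTC_OCO.
Context {R : realType} {n C : nat}.

(** The linear term is affine, the constraint term is convex because its weights are nonnegative,
    and each squared distance has convexity defect exactly [l * (1 - l) * l2norm (y - x) ^+ 2]. *)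
Lemma regularized_strongly_convex (p a b : 'rV[R]_n) (q : 'rV[R]_C)
    (h : 'rV[R]_n -> 'rV[R]_C) (alpha eta gamma : R) :
  0 < gamma -> (forall c, 0 <= q 0 c) ->
  (forall c, convex_function [set: convex_lmodType 'rV[R]_n]
     (fun y => h y 0 c)) ->
  let F y := dot p (y - a) + dot q (gamma *: h y)
             + alpha * l2norm (y - a) ^+ 2 + eta * l2norm (y - b) ^+ 2 in
  forall x y l, 0 < l < 1 -> F (l *: y + (1 - l) *: x) <=
    l * F y + (1 - l) * F x
    - l * (1 - l) * ((alpha + eta) * l2norm (y - x) ^+ 2).
Proof.
move=> gamma_gt0 q_ge0 hC F x y l /andP[l0 l1]; rewrite /F.
have l01 : 0 <= l <= 1 by rewrite !ltW.
rewrite !l2norm_sqr_conv.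
have -> : l *: y + (1 - l) *: x - a = l *: (y - a) + (1 - l) *: (x - a).
  by apply/rowP => i; rewrite !mxE; ring.
have q_conv : dot q (gamma *: h (l *: y + (1 - l) *: x)) <=
    l * dot q (gamma *: h y) + (1 - l) * dot q (gamma *: h x).
  rewrite /dot !mulr_sumr -big_split; apply: ler_sum => c _ /=.
  have := convex_function_le (hC c) y x l01.
  move=> /(ler_wpM2l (mulr_ge0 (q_ge0 c) (ltW gamma_gt0))).
  by rewrite !mxE; lra.
by rewrite dot_conv; lra.
Qed.

Variables (X0 : set 'rV[R]_n).
Variables (f : nat -> 'rV[R]_n -> R) (g : nat -> 'rV[R]_n -> 'rV[R]_C).

Lemma dtc_oco_objective_shift (tau : nat) (alpha eta gamma : R) x Q k y :
  dtc_oco_objective f g tau alpha eta gamma x Q (k.+1 + tau)%N y =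
  dot (gradient (f k.+1) (x k.+1)) (y - x k.+1)
  + dot (Q (k + tau)%N + gamma *: g k (x (k + tau)%N)) (gamma *: g k.+1 y)
  + alpha * l2norm (y - x k.+1) ^+ 2 + eta * l2norm (y - x (k + tau)%N) ^+ 2.
Proof. by rewrite /dtc_oco_objective addnK addSn !subn1. Qed.

Lemma dtc_oco_run_in (tau : nat) (alpha eta gamma : R) x Q t :
  dtc_oco_run X0 f g tau alpha eta gamma x Q -> (1 <= t)%N -> X0 (x t).
Proof.
case=> init step _ t_gt0; case: (leqP t tau) => [t_le|/step[]//].
by have [] := init t; rewrite ?t_gt0.
Qed.

(** The first branch of the max in the queue update gives this for positive [k]; for [k = 0] both
    summands vanish. *)
Lemma dtc_oco_weight_ge0 (tau : nat) (alpha eta gamma : R) x Q k c :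
  (1 <= tau)%N -> (forall y, g 0%N y = 0) ->
  dtc_oco_run X0 f g tau alpha eta gamma x Q ->
  0 <= (Q (k + tau)%N + gamma *: g k (x (k + tau)%N)) 0 c.
Proof.
move=> tau_gt0 g0 [init _ queue]; rewrite !mxE; case: k => [|k].
  have [_ ->] := init tau ltac:(by rewrite tau_gt0 leqnn).
  by rewrite g0 !mxE mulr0 addr0.
rewrite queue ?addSn ?ltnS ?leq_addl// -addSn addnK.
by rewrite -lerBlDr sub0r le_max lexx.
Qed.

(** The point is that the set is bounded above, by [4 * G ^+ 2]; [g0] covers index 0. *)
Lemma le_sup_variation (G : R) t y :
  (forall t, (1 <= t)%N -> forall y, X0 y -> l2norm (g t y) <= G) ->
  (forall y, g 0%N y = 0) -> 0 < G -> X0 y ->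
  l2norm (g t y - g (t - 1)%N y) ^+ 2 <=
  sup [set l2norm (g t z - g (t - 1)%N z) ^+ 2 | z in X0].
Proof.
move=> gG g0 G_gt0 Xy; apply: ub_le_sup; last by exists y.
have gG2 s z : X0 z -> l2norm (g s z) ^+ 2 <= G ^+ 2.
  move=> Xz; apply: l2norm_sqr_le; case: s => [|s]; last exact: gG.
  by rewrite g0 l2norm0 ltW.
exists (2 * (G ^+ 2 + G ^+ 2)) => _ [z Xz <-].
apply: (le_trans (l2norm_sqrD_le _ _)).
by rewrite l2normN ler_pM2l// lerD// gG2.
Qed.

End DTC_OCO.

Theorem theorem5 (R : realType) (n C T tau : nat)
    (hT : (1 <= T)%N) (htau : (1 <= tau)%N)
    (X0 : set 'rV[R]_n)
    (X0_compact : compact X0) (X0_convex : convex_set X0)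
    (f : nat -> 'rV[R]_n -> R) (g : nat -> 'rV[R]_n -> 'rV[R]_C)
    (f_convex : forall t, (1 <= t)%N ->
      convex_function [set: convex_lmodType 'rV[R]_n] (f t))
    (f_diff : forall t, (1 <= t)%N -> forall y, differentiable (f t) y)
    (g_convex : forall t, (1 <= t)%N -> forall c : 'I_C,
      convex_function [set: convex_lmodType 'rV[R]_n] (fun y => g t y 0 c))
    (g0 : forall y, g 0%N y = 0)
    (D : R) (D_gt0 : 0 < D)
    (grad_f_le : forall t, (1 <= t)%N -> forall y, X0 y ->
      l2norm (gradient (f t) y) <= D)
    (beta : R) (beta_gt0 : 0 < beta)
    (g_lipschitz : forall t, (1 <= t)%N -> forall y z, X0 y -> X0 z ->
      l2norm (g t y - g t z) <= beta * l2norm (y - z))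
    (G : R) (G_gt0 : 0 < G)
    (g_le : forall t, (1 <= t)%N -> forall y, X0 y -> l2norm (g t y) <= G)
    (epsilon : R) (epsilon_gt0 : 0 < epsilon)
    (g_slater : forall t, (1 <= t)%N -> exists y, X0 y /\
      forall c : 'I_C, g t y 0 c <= - epsilon)
    (radius : R) (radius_gt0 : 0 < radius)
    (X0_bounded : forall y z, X0 y -> X0 z -> l2norm (y - z) <= radius)
    (alpha eta gamma : R) (alpha_gt0 : 0 < alpha) (gamma_gt0 : 0 < gamma)
    (eta_ge : gamma ^+ 2 * beta ^+ 2 <= eta)
    (x : nat -> 'rV[R]_n) (Q : nat -> 'rV[R]_C)
    (xQ_run : dtc_oco_run X0 f g tau alpha eta gamma x Q)
    (xs : 'rV[R]_n) (xs_opt : static_benchmark X0 f g T xs) :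
  static_regret f T x xs <=
    D ^+ 2 / (4 * alpha) * T%:R + gamma ^+ 2 * G ^+ 2 / 2
    + gamma ^+ 2 * constraint_variation X0 g T
    + (alpha * tau%:R + eta) * radius ^+ 2 + D * radius * tau%:R.
Proof.
have [[Xxs gxs] _] := xs_opt; have [init step queue] := xQ_run.
(* Index [k] refers to the constraint [g k] as met by the decision of round [k + tau]; [Phi] is the
   drift potential. *)
pose w k := gamma *: g k (x (k + tau)%N); pose q k := Q (k + tau)%N.
pose Phi k := (l2norm (q k) ^+ 2 - l2norm (w k) ^+ 2) / 2.
pose d t := l2norm (xs - x t) ^+ 2.
pose V t := sup [set l2norm (g t z - g (t - 1)%N z) ^+ 2 | z in X0].
have Xx t : (1 <= t)%N -> X0 (x t) := dtc_oco_run_in xQ_run.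
have d_le t : (1 <= t)%N -> d t <= radius ^+ 2.
  by move=> t_gt0; apply/l2norm_sqr_le/X0_bounded => //; exact: Xx.
have tau_pos k : (1 <= k + tau)%N by rewrite addn_gt0 htau orbT.
have round k : (k < T)%N -> f k.+1 (x k.+1) - f k.+1 xs <=
    D ^+ 2 / (4 * alpha) + gamma ^+ 2 * V k.+1 - (Phi k.+1 - Phi k)
    + alpha * (d k.+1 - d (k.+1 + tau)%N)
    - eta * (d (k.+1 + tau)%N - d (k + tau)%N).
  move=> kT; set x' := x (k.+1 + tau)%N.
  have qw_ge0 c : 0 <= (q k + w k) 0 c.
    exact: (dtc_oco_weight_ge0 _ _ htau g0 xQ_run).
  have xmin : argmin X0
      (dtc_oco_objective f g tau alpha eta gamma x Q (k.+1 + tau)) x'.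
    by apply: step; rewrite addSn ltnS leq_addl.
  have : dtc_oco_objective f g tau alpha eta gamma x Q (k.+1 + tau) x'
      + (alpha + eta) * d (k.+1 + tau)%N <=
      dtc_oco_objective f g tau alpha eta gamma x Q (k.+1 + tau) xs.
    apply: (strongly_convex_argmin X0_convex _ xmin Xxs) => l l01.
    rewrite !dtc_oco_objective_shift.
    exact: (@regularized_strongly_convex _ _ _ _ _ _ _ (g k.+1) alpha eta gamma
      gamma_gt0 qw_ge0 (g_convex k.+1 isT) _ _ _ l01).
  rewrite !dtc_oco_objective_shift -/(d _) -/(d _) -/(q k) -/(w k) => x'_opt.
  have f_le := convex_gradient_le xs (f_convex k.+1 isT) (f_diff k.+1 isT (x k.+1)).
  (* Feasibility of [xs] is only known up to round [T], whence the restriction [k < T]. *)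
  have qw_xs : dot (q k + w k) (gamma *: g k.+1 xs) <= 0.
    rewrite /dot; apply: sumr_le0 => c _; rewrite mulr_ge0_le0// mxE.
    by rewrite pmulr_rle0// gxs.
  (* The term [alpha * l2norm (x' - x k.+1) ^+ 2] produced here cancels the same term of the
     objective at [x']. *)
  have young := young_dot (gradient (f k.+1) (x k.+1)) (x' - x k.+1) alpha_gt0.
  have gradD : l2norm (gradient (f k.+1) (x k.+1)) ^+ 2 / (4 * alpha) <=
      D ^+ 2 / (4 * alpha).
    rewrite ler_pM2r ?invr_gt0 ?mulr_gt0//; apply: l2norm_sqr_le.
    exact: grad_f_le (Xx _ _).
  have drift : - dot (q k + w k) (gamma *: g k.+1 x') <=
      Phi k - Phi k.+1 + l2norm (w k.+1 - w k) ^+ 2 / 2.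
    rewrite /Phi; apply: queue_drift => c.
    rewrite /q queue ?addSn ?ltnS ?leq_addl// -addSn addnK subn1 /=.
    by rewrite !mxE.
  have w_step : l2norm (w k.+1 - w k) ^+ 2 / 2 <=
      gamma ^+ 2 * V k.+1 + eta * l2norm (x' - x (k + tau)%N) ^+ 2.
    (* Separate the motion of the decision from the change of the constraint; the factor 2 of
       [l2norm_sqrD_le] cancels the division by 2. *)
    have -> : w k.+1 - w k = gamma *: ((g k.+1 x' - g k.+1 (x (k + tau)%N))
        + (g k.+1 (x (k + tau)%N) - g k (x (k + tau)%N))).
      by apply/rowP => c; rewrite !mxE; ring.
    rewrite l2norm_sqrZ.
    have gV : l2norm (g k.+1 (x (k + tau)%N) - g k (x (k + tau)%N)) ^+ 2 <=
        V k.+1.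
      have := le_sup_variation k.+1 g_le g0 G_gt0 (Xx _ (tau_pos k)).
      by rewrite -/(V _) subn1.
    have gL : l2norm (g k.+1 x' - g k.+1 (x (k + tau)%N)) ^+ 2 <=
        beta ^+ 2 * l2norm (x' - x (k + tau)%N) ^+ 2.
      by rewrite -exprMn; apply/l2norm_sqr_le/g_lipschitz => //; exact: Xx.
    have := ler_wpM2r (sqr_ge0 (l2norm (x' - x (k + tau)%N))) eta_ge.
    have := ler_wpM2l (sqr_ge0 gamma) (l2norm_sqrD_le
      (g k.+1 x' - g k.+1 (x (k + tau)%N))
      (g k.+1 (x (k + tau)%N) - g k (x (k + tau)%N))).
    have := ler_wpM2l (sqr_ge0 gamma) gV.
    have := ler_wpM2l (sqr_ge0 gamma) gL.
    by lra.
  by lra.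
have d_ge0 t : 0 <= d t by exact: sqr_ge0.
(* Only [tau] boundary differences survive, each at most [radius ^+ 2]. *)
have alpha_sum : alpha * (\sum_(0 <= k < T) (d k.+1 - d (k.+1 + tau)%N)) <=
    alpha * (tau%:R * radius ^+ 2).
  rewrite ler_pM2l// (telescope_window (fun k => d k.+1)).
  rewrite mulr_natl -[tau in leRHS]subn0 -sumr_const_nat.
  by apply: ler_sum => j _; rewrite lerBlDr ler_wpDr// d_le.
have eta_sum : eta * (d tau - d (T + tau)%N) <= eta * radius ^+ 2.
  rewrite ler_wpM2l//; last by rewrite lerBlDr ler_wpDr// d_le.
  by apply: le_trans eta_ge; rewrite mulr_ge0 ?sqr_ge0.
have Phi0 : Phi 0%N = 0.
  have [_ Qtau] := init tau ltac:(by rewrite htau leqnn).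
  by rewrite /Phi /q /w add0n Qtau g0 scaler0 subrr mul0r.
have PhiT : - Phi T <= gamma ^+ 2 * G ^+ 2 / 2.
  have : l2norm (w T) ^+ 2 <= gamma ^+ 2 * G ^+ 2.
    rewrite l2norm_sqrZ ler_pM2l ?exprn_gt0//.
    by apply/l2norm_sqr_le/g_le => //; exact: Xx.
  by have := sqr_ge0 (l2norm (q T)); rewrite /Phi; lra.
have DRtau : 0 <= D * radius * tau%:R by rewrite !mulr_ge0// ltW.
(* Shift the sums to start at 0, to match [round], then sum and telescope. *)
rewrite /static_regret /constraint_variation !big_add1/=.
have := ler_sum_nat (fun k (kT : (0 <= k < T)%N) => round k kT).
rewrite !(sumrB, big_split)/= -!mulr_sumr sumr_const_nat subn0 -mulr_natr.
have := telescope_sumr Phi (leq0n T); rewrite sumrB => ->.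
rewrite (@telescope_sumr _ 0 T (fun k => d (k + tau)%N))// add0n Phi0.
by rewrite -/(V _); lra.
Qed.
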